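(* Let $\Omega$ be a bounded domain, $\epsilon>0$, $\psi\in C(\Gamma_\epsilon)$ and $\varphi$ continuous on $\Omega_\epsilon\times[-\epsilon^2/2,\epsilon^2/2]$. For $T>\epsilon^2$ define the continuous function $F$ on $\Gamma_{\epsilon,T}$ by $F(x,t)=\psi(x)$ for $(x,t)\in\Gamma_\epsilon\times(\epsilon^2,T]$; $F(x,t)=\varphi(x,\epsilon^2/2)+\frac{2(t-\epsilon^2/2)}{\epsilon^2}\big(\psi(x)-\varphi(x,\epsilon^2/2)\big)$ for $(x,t)\in\Gamma_\epsilon\times(\epsilon^2/2,\epsilon^2]$; $F(x,t)=\varphi(x,t)$ for $(x,t)\in\Omega_\epsilon\times[-\epsilon^2/2,\epsilon^2/2]$ (where this lies in $\Gamma_{\epsilon,T}$). Let $u_\epsilon$ denote the bounded function satisfying $u_\epsilon(x,t)=(1-\delta(x,t))\operatorname{midrange}_{\nu\in S^{n-1}}\mathscr{A}_\epsilon u_\epsilon(x,t-\epsilon^2/2;\nu)+\delta(x,t)F(x,t)$ on $\Omega_{\epsilon,T}$ (this function does not depend on $T$ on common domains, so it is defined for all $t>-\epsilon^2/2$). Then for $x\in\Omega$, $$\lim_{T\to\infty}u_\epsilon(x,T)=U_\epsilon(x),$$ where $U_\epsilon$ is the (unique bounded) function on $\Omega_\epsilon$ satisfying $$U_\epsilon(x)=(1-\overline\delta(x))\operatorname{midrange}_{\nu\in S^{n-1}}\Big[\alpha U_\epsilon(x+\epsilon\nu)+\beta\fint_{B^\nu_\epsilon}U_\epsilon(x+h)\,d\mathcal{L}^{n-1}(h)\Big]+\overline\delta(x)\psi(x),$$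 with $\overline\delta=\lim_{t\to\infty}\delta(\cdot,t)$, i.e. $\overline\delta=0$ on $\Omega\setminus I_\epsilon$, $\overline\delta(x)=1-\operatorname{dist}(x,\partial\Omega)/\epsilon$ on $I_\epsilon$, $\overline\delta=1$ on $O_\epsilon$.
   Context: $\alpha,\beta\in(0,1)$ with $\alpha+\beta=1$. Notation: $I_\epsilon=\{x\in\Omega:\operatorname{dist}(x,\partial\Omega)<\epsilon\}$, $O_\epsilon=\{x\in\mathbb{R}^n\setminus\overline\Omega:\operatorname{dist}(x,\partial\Omega)<\epsilon\}$, $\Gamma_\epsilon=I_\epsilon\cup O_\epsilon\cup\partial\Omega$, $\Omega_\epsilon=\overline\Omega\cup O_\epsilon$; $\Omega_T=\Omega\times(0,T]$, $\partial_p\Omega_T=(\overline\Omega\times\{0\})\cup(\partial\Omega\times(0,T])$; $I_{\epsilon,T}=\{(x,t)\in\Omega\times[\epsilon^2/2,T]:\operatorname{dist}(x,\partial\Omega)<\epsilon\}\cup(\Omega\times(0,\epsilon^2/2))$; $O_{\epsilon,T}=\{(x,t)\in(\mathbb{R}^n\setminus\overline\Omega)\times(0,T]:\operatorname{dist}(x,\partial\Omega)<\epsilon\}\cup(\Omega_\epsilon\times(-\epsilon^2/2,0))$; $\Gamma_{\epsilon,T}=I_{\epsilon,T}\cup O_{\epsilon,T}\cup\partial_p\Omega_T$; $\Omega_{\epsilon,T}=\overline\Omega_T\cup O_{\epsilon,T}$. $\delta=0$ on $\Omega_T\setminus I_{\epsilon,T}$, $\delta(x,t)=\min\{1,1-\operatorname{dist}(x,\partial\Omega)/\epsilon\}\cdot\min\{1,1-\sqrt{2t}/\epsilon\}$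 on $I_{\epsilon,T}$, $\delta=1$ on $O_{\epsilon,T}$ (and on $\partial_p\Omega_T$). For $\nu\in S^{n-1}$, $B^\nu_\epsilon=\{h:|h|<\epsilon,\langle h,\nu\rangle=0\}$, $\mathcal{L}^{n-1}$ is $(n-1)$-dimensional Lebesgue measure, $\mathscr{A}_\epsilon u(x,t;\nu)=\alpha u(x+\epsilon\nu,t)+\beta\fint_{B^\nu_\epsilon}u(x+h,t)\,d\mathcal{L}^{n-1}(h)$, $\operatorname{midrange}_iA_i=\frac12(\sup_iA_i+\inf_iA_i)$.
   Formalization: The weight δ on I_{ε,T} is corrected to 1 − min{1, dist(x,∂Ω)/ε}·min{1, √(2t)/ε}, since the printed product tends to −∞ and has no limit δ̄ = 1 − dist/ε; also n ≥ 2, and u_ε(·,t), U_ε are taken Borel and u_ε bounded uniformly in T. *)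

(* Defs.v *)
From HB Require Import structures.
From mathcomp Require Import all_boot all_order all_algebra.
From mathcomp Require Import all_classical all_reals all_analysis.
Set Implicit Arguments. Unset Strict Implicit. Unset Printing Implicit Defensive.
Import Order.TTheory GRing.Theory Num.Theory.
Import numFieldNormedType.Exports.
Local Open Scope classical_set_scope.
Local Open Scope ring_scope.

Definition dotp (R : realType) (n : nat) (u v : 'rV[R]_n) : R :=
  \sum_(i < n) u 0 i * v 0 i.
Definition enorm (R : realType) (n : nat) (u : 'rV[R]_n) : R :=
  Num.sqrt (dotp u u).

Definition sphere (R : realType) (n : nat) : set 'rV[R]_n :=
  [set v | enorm v = 1].

Definition dist (R : realType) (n : nat) (x : 'rV[R]_n) (A : set 'rV[R]_n) : R :=
  inf [set enorm (x - y) | y in A].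

Definition bdry (R : realType) (n : nat) (A : set 'rV[R]_n) : set 'rV[R]_n :=
  closure A `\` interior A.

Definition Ieps (R : realType) n (Om : set 'rV[R]_n) (eps : R) : set 'rV[R]_n :=
  [set x | Om x /\ dist x (bdry Om) < eps].
Definition Oeps (R : realType) n (Om : set 'rV[R]_n) (eps : R) : set 'rV[R]_n :=
  [set x | ~ closure Om x /\ dist x (bdry Om) < eps].
Definition Gammaeps (R : realType) n (Om : set 'rV[R]_n) (eps : R) : set 'rV[R]_n :=
  Ieps Om eps `|` Oeps Om eps `|` bdry Om.
Definition Omegaeps (R : realType) n (Om : set 'rV[R]_n) (eps : R) : set 'rV[R]_n :=
  closure Om `|` Oeps Om eps.

Definition OmegaT (R : realType) n (Om : set 'rV[R]_n) (T : R) : set ('rV[R]_n * R) :=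
  [set p | Om p.1 /\ 0 < p.2 <= T].
Definition parbdry (R : realType) n (Om : set 'rV[R]_n) (T : R) : set ('rV[R]_n * R) :=
  [set p | (closure Om p.1 /\ p.2 = 0) \/ (bdry Om p.1 /\ 0 < p.2 <= T)].
Definition IepsT (R : realType) n (Om : set 'rV[R]_n) (eps T : R) : set ('rV[R]_n * R) :=
  [set p | (Om p.1 /\ eps ^+ 2 / 2 <= p.2 <= T /\ dist p.1 (bdry Om) < eps)
        \/ (Om p.1 /\ 0 < p.2 < eps ^+ 2 / 2)].
Definition OepsT (R : realType) n (Om : set 'rV[R]_n) (eps T : R) : set ('rV[R]_n * R) :=
  [set p | (~ closure Om p.1 /\ dist p.1 (bdry Om) < eps /\ 0 < p.2 <= T)
        \/ (Omegaeps Om eps p.1 /\ - (eps ^+ 2 / 2) < p.2 < 0)].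
Definition GammaepsT (R : realType) n (Om : set 'rV[R]_n) (eps T : R) : set ('rV[R]_n * R) :=
  IepsT Om eps T `|` OepsT Om eps T `|` parbdry Om T.
Definition OmegaepsT (R : realType) n (Om : set 'rV[R]_n) (eps T : R) : set ('rV[R]_n * R) :=
  closure (OmegaT Om T) `|` OepsT Om eps T.

Definition delta (R : realType) n (Om : set 'rV[R]_n) (eps T : R) (x : 'rV[R]_n) (t : R) : R :=
  if (x, t) \in IepsT Om eps T then
    1 - Num.min 1 (dist x (bdry Om) / eps) * Num.min 1 (Num.sqrt (2 * t) / eps)
  else if (x, t) \in OepsT Om eps T `|` parbdry Om T then 1 else 0.

(* stationary weight: limit of delta(., t) as t -> oo *)
Definition deltabar (R : realType) n (Om : set 'rV[R]_n) (eps : R) (x : 'rV[R]_n) : R :=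
  if x \in Ieps Om eps then 1 - dist x (bdry Om) / eps
  else if x \in Oeps Om eps `|` bdry Om then 1 else 0.

Definition Fdat (R : realType) n (eps : R) (psi : 'rV[R]_n -> R) (phi : 'rV[R]_n -> R -> R)
    (x : 'rV[R]_n) (t : R) : R :=
  if eps ^+ 2 < t then psi x
  else if eps ^+ 2 / 2 < t then
    phi x (eps ^+ 2 / 2) + 2 * (t - eps ^+ 2 / 2) / eps ^+ 2 * (psi x - phi x (eps ^+ 2 / 2))
  else phi x t.

(* ---- k-dimensional Lebesgue integral, as an iterated one-dimensional
        Lebesgue integral (Fubini) ---- *)
Fixpoint iint (R : realType) (k : nat) : ('rV[R]_k -> R) -> R :=
  match k return ('rV[R]_k -> R) -> R with
  | 0 => fun f => f 0
  | k'.+1 => fun f =>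
      Rintegral (@lebesgue_measure R) setT
        (fun a : R => @iint R k' (fun y : 'rV[R]_k' => f (row_mx (const_mx a : 'rV[R]_1) y : 'rV[R]_(1 + k'))))
  end.

Definition emb (R : realType) (n : nat) (y : 'rV[R]_n.-1) : 'rV[R]_n :=
  \row_(i < n) (if @insub _ (fun k => (k < n.-1)%N) ('I_n.-1) (val i) is Some j then y 0 j else 0).

Definition elast (R : realType) (n : nat) : 'rV[R]_n :=
  \row_(i < n) (if val i == n.-1 then 1 else 0).

(* Householder reflection mapping e_n to nu: an orthogonal map carrying the
   hyperplane e_n^perp = R^{n-1} x {0} isometrically onto nu^perp *)
Definition hh (R : realType) (n : nat) (nu : 'rV[R]_n) (z : 'rV[R]_n) : 'rV[R]_n :=
  let w := elast R n - nu in
  if w == 0 then z else z - (2 * dotp z w / dotp w w) *: w.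

(* mean value over the (n-1)-dimensional disc B^nu_eps w.r.t. L^{n-1} *)
Definition favg (R : realType) (n : nat) (eps : R) (nu : 'rV[R]_n) (g : 'rV[R]_n -> R) : R :=
  iint (fun y : 'rV[R]_n.-1 => ((enorm y < eps)%R : bool)%:R * g (hh nu (emb y)))
  / iint (fun y : 'rV[R]_n.-1 => ((enorm y < eps)%R : bool)%:R).

Definition midrange (R : realType) (A : set R) : R := (sup A + inf A) / 2.

Definition Aeps (R : realType) n (alpha beta eps : R) (u : 'rV[R]_n -> R -> R)
    (x : 'rV[R]_n) (t : R) (nu : 'rV[R]_n) : R :=
  alpha * u (x + eps *: nu) t + beta * favg eps nu (fun h => u (x + h) t).

Definition borel_on (R : realType) n (D : set 'rV[R]_n) (f : 'rV[R]_n -> R) : Prop :=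
  forall B : set R, measurable B ->
    <<s [set O : set 'rV[R]_n | open O] >> (D `&` f @^-1` B).

(* Main.v *)
(** The barrier [v x = 2 K - exp (lam |x|^2)] is a strict supersolution of the
    averaging step, uniformly in the direction [nu]: as the mean of a linear form
    over the disc vanishes and that of [|h|^2] is a positive constant,
    [exp s >= 1 + s] shows that for large [lam] the [beta]-part alone doubles
    [exp (lam |x|^2)], so that one step maps [v] below [kap * v] with [kap < 1].
    For [t > eps^2] the parabolic and stationary weights and data coincide, and
    the midrange is 1-Lipschitz for the sup distance, hence a bound
    [|u - U| <= m * v] at time [t - eps^2 / 2] improves to
    [|u - U| <= m * kap * v] at time [t]; outside [Om] both functions equal [psi]. *)
Require Import Defs.
From HB Require Import structures.
From mathcomp Require Import all_boot all_order all_algebra.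
From mathcomp Require Import all_classical all_reals all_analysis.
From mathcomp Require Import measurable_realfun ring lra.
Set Implicit Arguments. Unset Strict Implicit. Unset Printing Implicit Defensive.
Import Order.TTheory GRing.Theory Num.Theory.
Import numFieldNormedType.Exports.
Local Open Scope classical_set_scope.
Local Open Scope ring_scope.

(** * Iterated integrals of bounded functions with bounded support *)

(* Joint measurability, tested on all families of measurable coordinates, so
   that no sigma-algebra on ['rV_k] has to be chosen. *)
Definition vmeas {R : realType} {d} {T : measurableType d} {k}
    (f : T -> 'rV[R]_k -> R) : Prop :=
  forall d' (S : measurableType d') (p : S -> T) (q : 'I_k -> S -> R),
    measurable_fun setT p -> (forall i, measurable_fun setT (q i)) ->
    measurable_fun setT (fun s => f (p s) (\row_i q i s)).

(** The constants are uniform in the parameter, and the support is bounded coordinate by coordinate,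
    so that both properties pass to slices in the first coordinate. *)
Definition bsupp {R : realType} {T : Type} {k} (f : T -> 'rV[R]_k -> R) : Prop :=
  exists C r : R, forall x y,
    `|f x y| <= C /\ forall i, r < `|y 0 i| -> f x y = 0.

(** This is the [row_mx] of the recursion of [iint], so that [iintS] holds by conversion. *)
Definition cons_rv {R : realType} {k} (a : R) (y : 'rV[R]_k) : 'rV[R]_k.+1 :=
  row_mx (const_mx a : 'rV[R]_1) y.

Lemma cons_rv0 (R : realType) k (a : R) (y : 'rV[R]_k) :
  cons_rv a y 0 ord0 = a.
Proof.
have := row_mxEl (const_mx a : 'rV[R]_1) y 0 ord0; rewrite [RHS]mxE => e.
rewrite -[RHS]e.
by congr (row_mx _ _ _ _); apply/val_inj.
Qed.

Lemma cons_rvS (R : realType) k (a : R) (y : 'rV[R]_k) (i : 'I_k) :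
  cons_rv a y 0 (lift ord0 i) = y 0 i.
Proof.
rewrite -[RHS](row_mxEr (const_mx a : 'rV[R]_1) y 0 i).
by congr (row_mx _ _ _ _); apply/val_inj.
Qed.

Lemma cons_rvN (R : realType) k (a : R) (y : 'rV[R]_k) :
  cons_rv (- a) (- y) = - cons_rv a y.
Proof.
apply/rowP => i; rewrite [RHS]mxE.
by case: (unliftP ord0 i) => [j|] ->; rewrite ?cons_rvS ?cons_rv0 ?mxE.
Qed.

Lemma iintS (R : realType) k (f : 'rV[R]_k.+1 -> R) :
  iint f = \int[lebesgue_measure]_a iint (fun y => f (cons_rv a y)).
Proof. by []. Qed.

Lemma iint_eq0 (R : realType) k (f : 'rV[R]_k -> R) :
  (forall y, f y = 0) -> iint f = 0.
Proof.
elim: k f => [|k IH] f f0; first exact: f0.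
rewrite iintS (@eq_Rintegral _ _ _ _ _ (cst 0)); last first.
  by move=> a _; exact: IH.
by rewrite Rintegral_cst// mul0r.
Qed.

Lemma integrable_bsupp (R : realType) (h : R -> R) (C r : R) :
  measurable_fun setT h -> (forall a, `|h a| <= C) ->
  (forall a, r < `|a| -> h a = 0) ->
  (@lebesgue_measure R).-integrable setT (EFin \o h).
Proof.
move=> mh hC hr.
have -> : EFin \o h = (EFin \o h) \_ `[- r, r].
  apply/funext => a; rewrite patchE/=; case: ifPn => // /negP.
  rewrite inE/= in_itv/= -ler_norml => /negP; rewrite -ltNge => /hr ->//.
have mI : measurable (`[- r, r]%classic : set (measurableTypeR R)) by [].
apply/(@integrable_mkcond _ _ _ (@lebesgue_measure R) _ (EFin \o h) mI).
apply: measurable_bounded_integrable => //.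
- have : (lebesgue_measure ([set` `[- r, r]%R] : set R) < +oo)%E.
    by rewrite lebesgue_measure_itv/=; case: ifPn => _; rewrite ?ltry.
  exact.
- exact: measurable_funS mh.
- exists C; split => [|M CM a _]; first exact: num_real.
  exact: le_trans (hC a) (ltW CM).
Qed.

(** The factor stays the integral of an indicator instead of [2 * r], which covers a negative [r] as
    well. *)
Lemma Rintegral_bsupp_bound (R : realType) (h : R -> R) (C r : R) :
  measurable_fun setT h -> (forall a, `|h a| <= C) ->
  (forall a, r < `|a| -> h a = 0) ->
  `|\int[lebesgue_measure]_a h a| <=
    C * \int[lebesgue_measure]_a (\1_(`[- r, r]%classic) a : R).
Proof.
move=> mh hC hr.
have ih := @integrable_bsupp _ _ _ _ mh hC hr.
apply: (le_trans (le_normr_Rintegral _ ih)) => //.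
have i1 : (@lebesgue_measure R).-integrable setT (EFin \o \1_(`[- r, r]%classic)).
  exact: integrable_indic_itv.
rewrite -RintegralZl//.
apply: le_Rintegral => //.
- exact: integrable_norm.
- exact: (@integrableZl _ _ _ _ setT measurableT C _ i1).
- move=> a _; rewrite indicE; case: (boolP (a \in _)); first by rewrite mulr1.
  rewrite notin_setE/= in_itv/= -ler_norml => /negP; rewrite -ltNge => /hr ->.
  by rewrite mulr0 normr0.
Qed.

(** Tonelli applies to the positive and negative parts separately, so measurability holds also where
    the extended integral is infinite and [fine] returns 0. *)
Lemma measurable_fun_Rintegral (R : realType) d (T : measurableType d)
    (G : T * R -> R) : measurable_fun setT G ->
  measurable_fun setT (fun x => \int[lebesgue_measure]_a G (x, a)).
Proof.
move=> mG.
apply: (@measurableT_comp _ _ _ _ _ _ (@fine R)).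
  exact: fine_measurable.
have -> : (fun x => \int[lebesgue_measure]_a (G (x, a))%:E)%E =
  (fun x => fubini_F lebesgue_measure ((EFin \o G)^\+) x
          - fubini_F lebesgue_measure ((EFin \o G)^\-) x)%E.
  by apply/funext => x; rewrite [LHS]integralE; congr (_ - _)%E;
  apply: eq_integral => a _; rewrite ?funeposE ?funenegE.
have mG' : measurable_fun setT (EFin \o G) by exact/measurable_EFinP.
apply: emeasurable_funB.
- apply: measurable_fun_fubini_tonelli_F => //.
  exact: measurable_funepos.
- apply: measurable_fun_fubini_tonelli_F => //.
  exact: measurable_funeneg.
Qed.

Lemma vmeas_cons {R : realType} {d} {T : measurableType d} {k}
    (f : T -> 'rV[R]_k.+1 -> R) : vmeas f ->
  vmeas (fun (xa : T * R) y => f xa.1 (cons_rv xa.2 y)).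
Proof.
move=> mf d' S p q mp mq.
pose q' (i : 'I_k.+1) (s : S) := cons_rv (p s).2 (\row_j q j s) 0 i.
rewrite [X in measurable_fun _ X](_ : _ =
  (fun s => f (p s).1 (\row_i q' i s))); last first.
  apply/funext => s; congr f; apply/rowP => i.
  by rewrite mxE.
apply: mf; first exact: measurableT_comp.
move=> i; rewrite /q'; case: (unliftP ord0 i) => [j|] ->.
  under eq_fun do rewrite cons_rvS mxE.
  exact: mq.
under eq_fun do rewrite cons_rv0.
exact: measurableT_comp.
Qed.

(** The induction generalises the parameter space: the inner integral is a family over [T * R], the
    coordinate still to be integrated having joined the parameter. Both conclusions are proved
    together because the bound on the outer integral uses both. *)
Lemma iint_param {R : realType} {k d} {T : measurableType d}
    (f : T -> 'rV[R]_k -> R) : vmeas f -> bsupp f ->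
  measurable_fun setT (fun x => iint (f x)) /\
  exists C : R, forall x, `|iint (f x)| <= C.
Proof.
elim: k d T f => [|k IH] d T f mf [C [r fCr]].
  split; last by exists C => x; exact: (fCr x 0).1.
  rewrite [X in measurable_fun _ X](_ : _ =
    (fun s => f s (\row_i (fun (_ : 'I_0) _ => 0) i s))); last first.
    by apply/funext => x /=; congr f; apply/rowP => -[].
  by apply: (mf _ _ id (fun (_ : 'I_0) _ => 0)) => //; exact: measurable_id.
have [|mG [C' GC']] := IH _ _ _ (vmeas_cons mf).
  exists C, r => -[x a] y; split; first exact: (fCr _ _).1.
  by move=> i ri; apply: (fCr _ _).2 (lift ord0 i) _; rewrite cons_rvS.
split; first exact: measurable_fun_Rintegral mG.
exists (C' * \int[lebesgue_measure]_a (\1_(`[- r, r]%classic) a : R)) => x.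
rewrite iintS; apply: Rintegral_bsupp_bound.
- exact: (measurableT_comp mG (pair1_measurable x)).
- by move=> a; exact: (GC' (x, a)).
- move=> a ra; apply: iint_eq0 => y.
  by apply: (fCr _ _).2 ord0 _; rewrite cons_rv0.
Qed.

(** The case of a one-point parameter space, which lets [iint_param] serve for single functions. *)
Definition iintable {R : realType} {k} (f : 'rV[R]_k -> R) : Prop :=
  vmeas (fun (_ : unit) => f) /\ bsupp (fun (_ : unit) => f).

Lemma iintable_slice {R : realType} {k} (f : 'rV[R]_k.+1 -> R) (a : R) :
  iintable f -> iintable (fun y => f (cons_rv a y)).
Proof.
move=> [mf [C [r fCr]]]; split; last first.
  exists C, r => x y; split; first exact: (fCr _ _).1.
  by move=> i ri; apply: (fCr _ _).2 (lift ord0 i) _ => //; rewrite cons_rvS.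
move=> d' S p q mp mq.
apply: (vmeas_cons mf (p := fun s => (tt, a))) => //.
Qed.

Lemma integrable_iint {R : realType} {k} (f : 'rV[R]_k.+1 -> R) :
  iintable f ->
  (@lebesgue_measure R).-integrable setT
     (EFin \o (fun a => iint (fun y => f (cons_rv a y)))).
Proof.
move=> [mf [C [r fCr]]].
have [|mG [C' GC']] := iint_param (vmeas_cons mf).
  exists C, r => -[x a] y; split; first exact: (fCr _ _).1.
  by move=> i ri; apply: (fCr _ _).2 (lift ord0 i) _ => //; rewrite cons_rvS.
apply: (@integrable_bsupp _ _ C' r).
- exact: (measurableT_comp mG (pair1_measurable tt)).
- by move=> a; exact: (GC' (tt, a)).
- move=> a ra; apply: iint_eq0 => y.
  by apply: (fCr tt _).2 ord0 _; rewrite cons_rv0.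
Qed.

Lemma iint_le {R : realType} {k} (f g : 'rV[R]_k -> R) :
  iintable f -> iintable g -> (forall y, f y <= g y) -> iint f <= iint g.
Proof.
elim: k f g => [|k IH] f g kf kg fg; first exact: fg.
rewrite !iintS; apply: le_Rintegral => //; try exact: integrable_iint.
by move=> a _; apply: IH => //; exact: iintable_slice.
Qed.

Lemma iintD {R : realType} {k} (f g : 'rV[R]_k -> R) :
  iintable f -> iintable g -> iint (fun y => f y + g y) = iint f + iint g.
Proof.
elim: k f g => [|k IH] f g kf kg //.
rewrite !iintS -RintegralD//; try exact: integrable_iint.
by apply: eq_Rintegral => a _; apply: IH => //; exact: iintable_slice.
Qed.

Lemma iintZ {R : realType} {k} (c : R) (f : 'rV[R]_k -> R) :
  iintable f -> iint (fun y => c * f y) = c * iint f.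
Proof.
elim: k f => [|k IH] f kf //.
rewrite !iintS -RintegralZl//; try exact: integrable_iint.
by apply: eq_Rintegral => a _; apply: IH => //; exact: iintable_slice.
Qed.

(** Lebesgue measure is its own pushforward under negation; the change of variables is made for
    nonnegative functions and applied to the two parts. *)
Lemma RintegralN_arg (R : realType) (h : R -> R) :
  (@lebesgue_measure R).-integrable setT (EFin \o h) ->
  \int[lebesgue_measure]_a h (- a) = \int[lebesgue_measure]_a h a.
Proof.
move=> ih; rewrite /Rintegral; congr fine.
have mh : measurable_fun setT (EFin \o h) by case/integrableP: ih.
pose opp := (-%R : R -> measurableTypeR R).
have mopp : measurable_fun setT opp by exact: oppr_measurable.
rewrite [RHS]integralE [LHS]integralE.
have ge0 (g : R -> \bar R) : measurable_fun setT g -> (forall r, 0 <= g r)%E ->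
    (\int[lebesgue_measure]_r g (- r)%R = \int[lebesgue_measure]_r g r)%E.
  move=> mg g0.
  transitivity (\int[pushforward lebesgue_measure opp]_r g r)%E.
    by rewrite ge0_integral_pushforward.
  by apply: eq_measure_integral => A mA _; exact: lebesgue_measureN.
congr (_ - _)%E.
- rewrite -[RHS]ge0//; last exact: measurable_funepos.
  by apply: eq_integral => a _; rewrite !funeposE.
- rewrite -[RHS]ge0//; last exact: measurable_funeneg.
  by apply: eq_integral => a _; rewrite !funenegE.
Qed.

Lemma iintN {R : realType} {k} (f : 'rV[R]_k -> R) :
  iintable f -> iint (fun y => f (- y)) = iint f.
Proof.
elim: k f => [|k IH] f kf; first by rewrite /= oppr0.
rewrite !iintS -[RHS]RintegralN_arg; last exact: integrable_iint.
apply: eq_Rintegral => a _ /=.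
rewrite -(IH (fun y => f (cons_rv (- a) y))); last exact: iintable_slice.
by congr iint; apply/funext => y; rewrite cons_rvN.
Qed.

(** * Borel functions of several real variables *)

(** An open set is the union of the boxes with rational centre and radius [1 / (k + 1)] that it
    contains. There are countably many, and each is cut out by finitely many coordinate
    inequalities. *)
Lemma measurable_preimage_open {R : realType} {d} {S : measurableType d} {n}
    (f : S -> 'rV[R]_n) (O : set 'rV[R]_n) :
  (forall i, measurable_fun setT (fun s => f s 0 i)) -> open O ->
  measurable (f @^-1` O).
Proof.
move=> mf oO.
pose box (ck : 'rV[rat]_n * nat) : set 'rV[R]_n :=
  [set y | forall i, `|ratr (ck.1 0 i) - y 0 i| < ck.2.+1%:R^-1].
have -> : f @^-1` O =
    \bigcup_ck (f @^-1` (if `[< box ck `<=` O >] then box ck else set0)).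
  apply/seteqP; split => s /=; last first.
    by case=> ck _ /=; case: asboolP => // sub /sub.
  move=> Os; move: oO; rewrite openE => /(_ _ Os) /nbhs_ballP[e /= e0 feO].
  (* A box of this radius that contains [f s] has all its points within [2 / (k + 1) < e] of [f s],
     hence lies in the ball. *)
  have [k ke] : exists k, 0 + k.+1%:R^-1 < e / 2 :> R.
    by apply: ltr_add_invr; rewrite divr_gt0.
  rewrite add0r in ke.
  have k0 : 0 < k.+1%:R^-1 :> R by rewrite invr_gt0.
  have cP i : exists q : rat, `|ratr q - f s 0 i| < k.+1%:R^-1.
    have [|q] := @rat_in_itvoo R (f s 0 i - k.+1%:R^-1) (f s 0 i + k.+1%:R^-1).
      by rewrite ltrBlDr -addrA ltrDl addr_gt0.
    by rewrite in_itv/= -ltr_distl => ?; exists q.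
  pose c : 'rV[rat]_n := \row_i (sval (cid (cP i))).
  have fsc : box (c, k) (f s).
    by move=> i /=; rewrite mxE; exact: (svalP (cid (cP i))).
  exists (c, k) => //=; rewrite asboolT//.
  move=> y /= yc; apply: feO; split => // i j; rewrite /ball/= !ord1.
  have := fsc j; have := yc j => /= yj sj.
  rewrite (_ : _ - _ = (ratr (c 0 j) - y 0 j) - (ratr (c 0 j) - f s 0 j)).
    apply: (le_lt_trans (ler_normB _ _)); rewrite (splitr e).
    by apply: ltrD; [exact: lt_trans yj ke|exact: lt_trans sj ke].
  by ring.
apply: countable_bigcupT_measurable => // -[c k].
case: asboolP => _; last by rewrite preimage_set0.
have -> : f @^-1` box (c, k) =
    \bigcap_(i in setT) [set s | `|ratr (c 0 i) - f s 0 i| < k.+1%:R^-1].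
  by apply/seteqP; split => s /= h i; [move=> _|]; exact: h.
apply: fin_bigcap_measurable => // i _.
rewrite -[X in measurable X]setTI.
have : measurable_fun setT (fun s => `|ratr (c 0 i) - f s 0 i| < k.+1%:R^-1 :> R).
  apply: measurable_fun_ltr => //; apply: measurableT_comp => //.
  exact: measurable_funB.
by move/(_ measurableT [set true]); exact.
Qed.

(** The sets with measurable preimage form a sigma-algebra containing the open sets. *)
Lemma measurable_preimage_borel {R : realType} {d} {S : measurableType d} {n}
    (f : S -> 'rV[R]_n) (A : set 'rV[R]_n) :
  (forall i, measurable_fun setT (fun s => f s 0 i)) ->
  <<s [set O : set 'rV[R]_n | open O] >> A -> measurable (f @^-1` A).
Proof.
move=> mf; apply: (@smallest_sub _ _ _ [set A | measurable (f @^-1` A)]).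
  split => /=; first by rewrite preimage_set0.
  - by move=> B mB; rewrite setTD preimage_setC; exact: measurableC.
  - by move=> F mF; rewrite preimage_bigcup; exact: bigcup_measurable.
by move=> O; exact: measurable_preimage_open.
Qed.

Definition vborel {R : realType} {n} (g : 'rV[R]_n -> R) : Prop :=
  forall d (S : measurableType d) (f : S -> 'rV[R]_n),
    (forall i, measurable_fun setT (fun s => f s 0 i)) ->
    measurable_fun setT (g \o f).

(** Where [0 \in B], the preimage also contains the complement of [D]; that [D] is itself Borel is
    the hypothesis at [B = setT]. *)
Lemma borel_on_vborel {R : realType} {n} (D : set 'rV[R]_n) (g : 'rV[R]_n -> R) :
  borel_on D g -> vborel (fun x => if x \in D then g x else 0).
Proof.
move=> bg d S f mf _ B mB; rewrite setTI.
have -> : ((fun x => if x \in D then g x else 0) \o f) @^-1` B =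
    f @^-1` (D `&` g @^-1` B) `|`
    (if 0 \in B then ~` (f @^-1` (D `&` g @^-1` setT)) else set0).
  apply/seteqP; split => s /=.
    case: (boolP (f s \in D)).
      by rewrite inE => Ds gB; left.
    rewrite notin_setE => nDs B0; right; rewrite mem_set//=.
    by case.
  case=> [[Ds gB]|]; first by rewrite mem_set.
  case: ifPn => //; rewrite inE => B0 /= nDs.
  by rewrite memNset// => Ds; apply: nDs.
apply: measurableU; first by apply: measurable_preimage_borel => //; exact: bg.
case: ifPn => // _; apply: measurableC.
by apply: measurable_preimage_borel => //; exact: bg.
Qed.

Lemma vborel_shift {R : realType} {n} (x : 'rV[R]_n) (g : 'rV[R]_n -> R) :
  vborel g -> vborel (fun h => g (x + h)).
Proof.
move=> bg d S f mf.
apply: (bg _ _ (fun s => x + f s)) => i.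
under eq_fun do rewrite mxE.
exact: measurable_funD.
Qed.

Lemma vborel_cst {R : realType} {n} (c : R) : vborel (fun _ : 'rV[R]_n => c).
Proof. by move=> d S f mf; exact: measurable_cst. Qed.

Lemma vborelD {R : realType} {n} (g1 g2 : 'rV[R]_n -> R) :
  vborel g1 -> vborel g2 -> vborel (fun h => g1 h + g2 h).
Proof.
by move=> b1 b2 d S f mf; apply: measurable_funD; [exact: b1|exact: b2].
Qed.

Lemma vborelM {R : realType} {n} (g1 g2 : 'rV[R]_n -> R) :
  vborel g1 -> vborel g2 -> vborel (fun h => g1 h * g2 h).
Proof.
by move=> b1 b2 d S f mf; apply: measurable_funM; [exact: b1|exact: b2].
Qed.

Lemma vborel_expR {R : realType} {n} (g : 'rV[R]_n -> R) :
  vborel g -> vborel (fun h => expR (g h)).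
Proof.
move=> bg d S f mf.
by apply: (@measurableT_comp _ _ _ _ _ _ (@expR R)) => //; exact: bg.
Qed.

Lemma vborel_dotp {R : realType} {n} (x : 'rV[R]_n) : vborel (dotp x).
Proof.
move=> d S f mf; apply: measurable_sum => i.
exact: measurable_funM.
Qed.

Lemma vborel_dotpp {R : realType} {n} : vborel (fun x : 'rV[R]_n => dotp x x).
Proof.
move=> d S f mf; apply: measurable_sum => i.
exact: measurable_funM.
Qed.

(** * Positivity of iterated integrals *)

Lemma iint_ge0 {R : realType} {k} (f : 'rV[R]_k -> R) :
  (forall y, 0 <= f y) -> 0 <= iint f.
Proof.
elim: k f => [|k IH] f f0; first exact: f0.
by rewrite iintS; apply: Rintegral_ge0 => a _; exact: IH.
Qed.

(** Comparison with [c] times the indicator of a cube, one coordinate at a time; it serves to show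
    that the disc has positive mass and [|h|^2] a positive mean. *)
Lemma iint_box_le {R : realType} {k} (f : 'rV[R]_k -> R) (a b c : R) :
  a < b -> iintable f -> (forall y, 0 <= f y) -> 0 <= c ->
  (forall y : 'rV[R]_k, (forall i, a <= y 0 i <= b) -> c <= f y) ->
  c * (b - a) ^+ k <= iint f.
Proof.
move=> ab; elim: k f => [|k IH] f kf f0 c0 fc.
  by rewrite expr0 mulr1; apply: fc => -[].
rewrite iintS exprSr mulrA.
have i1 : (@lebesgue_measure R).-integrable setT (EFin \o \1_(`[a, b]%classic)).
  exact: integrable_indic_itv.
have e1 : \int[lebesgue_measure]_t (\1_(`[a, b]%classic) t : R) = b - a.
  rewrite /Rintegral integral_indic//= setIT.
  have -> : lebesgue_measure (`[a, b]%classic : set R) = (b - a)%:E.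
    by rewrite lebesgue_measure_itv/= lte_fin ab.
  by [].
rewrite -[X in _ * X <= _]e1 -RintegralZl//; apply: le_Rintegral => //.
- exact: (@integrableZl _ _ _ _ setT measurableT _ _ i1).
- exact: integrable_iint.
move=> t _; rewrite indicE; case: (boolP (t \in _)); last first.
  by rewrite mulr0 => _; exact: iint_ge0.
rewrite inE/= in_itv/= => tab; rewrite mulr1; apply: IH => //.
  exact: iintable_slice.
move=> y yab; apply: fc => i.
by case: (unliftP ord0 i) => [j|] ->; rewrite ?cons_rvS ?cons_rv0.
Qed.

(** * Euclidean norm, Householder reflection and the embedded hyperplane *)

Lemma dotpC {R : realType} {n} (x y : 'rV[R]_n) : dotp x y = dotp y x.
Proof. by apply: eq_bigr => i _; rewrite mulrC. Qed.

Lemma dotpDr {R : realType} {n} (x y z : 'rV[R]_n) :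
  dotp x (y + z) = dotp x y + dotp x z.
Proof. by rewrite -big_split; apply: eq_bigr => i _; rewrite mxE mulrDr. Qed.

Lemma dotpZr {R : realType} {n} (c : R) (x y : 'rV[R]_n) :
  dotp x (c *: y) = c * dotp x y.
Proof. by rewrite mulr_sumr; apply: eq_bigr => i _; rewrite mxE mulrCA. Qed.

Lemma dotpNr {R : realType} {n} (x y : 'rV[R]_n) : dotp x (- y) = - dotp x y.
Proof. by rewrite -scaleN1r dotpZr mulN1r. Qed.

Lemma dotp_sqrD {R : realType} {n} (x h : 'rV[R]_n) :
  dotp (x + h) (x + h) = dotp x x + 2 * dotp x h + dotp h h.
Proof. by rewrite dotpDr ![dotp (x + h) _]dotpC !dotpDr (dotpC h x); ring. Qed.

Lemma dotp_ge0 {R : realType} {n} (x : 'rV[R]_n) : 0 <= dotp x x.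
Proof. by apply: sumr_ge0 => i _; rewrite -expr2 sqr_ge0. Qed.

Lemma dotp_ge_coord {R : realType} {n} (x : 'rV[R]_n) i :
  x 0 i ^+ 2 <= dotp x x.
Proof.
rewrite /dotp (bigD1 i)//= -expr2 lerDl.
by apply: sumr_ge0 => j _; rewrite -expr2 sqr_ge0.
Qed.

Lemma dotp_eq0 {R : realType} {n} (x : 'rV[R]_n) : dotp x x = 0 -> x = 0.
Proof.
move=> x0; apply/rowP => i; rewrite mxE; apply/eqP.
rewrite -sqrf_eq0 eq_le sqr_ge0 andbT -x0; exact: dotp_ge_coord.
Qed.

Lemma dotp_sqrD_le {R : realType} {n} (x h : 'rV[R]_n) :
  dotp (x + h) (x + h) <= 2 * dotp x x + 2 * dotp h h.
Proof.
have := dotp_ge0 (x - h); rewrite !dotp_sqrD !dotpNr (dotpC (- h)) dotpNr.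
lra.
Qed.

Lemma enormE2 {R : realType} {n} (x : 'rV[R]_n) : enorm x ^+ 2 = dotp x x.
Proof. by rewrite sqr_sqrtr ?dotp_ge0. Qed.

Lemma enorm_ge0 {R : realType} {n} (x : 'rV[R]_n) : 0 <= enorm x.
Proof. exact: sqrtr_ge0. Qed.

Lemma enorm_lt {R : realType} {n} (x : 'rV[R]_n) (e : R) : 0 < e ->
  (enorm x < e) = (dotp x x < e ^+ 2).
Proof. by move=> e0; rewrite -enormE2 ltr_pXn2r// nnegrE ?enorm_ge0 ?ltW. Qed.

Lemma enormZ {R : realType} {n} (c : R) (x : 'rV[R]_n) :
  enorm (c *: x) = `|c| * enorm x.
Proof.
by rewrite /enorm dotpZr dotpC dotpZr mulrA -expr2 sqrtrM ?sqr_ge0// sqrtr_sqr.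
Qed.

(** In [|z - c w|^2] with [c = 2 <z, w> / <w, w>] the cross term cancels the square term, so the
    disc is carried into a ball of the same radius. *)
Lemma dotp_hh {R : realType} {n} (nu z : 'rV[R]_n) :
  dotp (hh nu z) (hh nu z) = dotp z z.
Proof.
rewrite /hh; case: eqVneq => // w0; set w := _ - nu in w0 *.
have ww : dotp w w != 0 by apply: contraNneq w0 => /dotp_eq0 ->.
rewrite dotp_sqrD !dotpNr !dotpZr [dotp (- _) _]dotpC dotpNr dotpZr.
by field.
Qed.

Lemma hhN {R : realType} {n} (nu z : 'rV[R]_n) : hh nu (- z) = - hh nu z.
Proof.
rewrite /hh; case: ifP => // _.
by rewrite dotpC dotpNr dotpC mulrN mulNr scaleNr opprB opprK addrC.
Qed.

Lemma emb_widen {R : realType} {k} (y : 'rV[R]_k) (i : 'I_k) :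
  emb (n := k.+1) y 0 (widen_ord (leqnSn k) i) = y 0 i.
Proof.
rewrite mxE; case: insubP => [j _ ji|/negP[]]; last exact: (ltn_ord i).
by have -> : j = i by exact: val_inj.
Qed.

Lemma emb_max {R : realType} {k} (y : 'rV[R]_k) : emb (n := k.+1) y 0 ord_max = 0.
Proof. by rewrite mxE; case: insubP => //= j; rewrite ltnn. Qed.

Lemma dotp_emb {R : realType} {k} (y : 'rV[R]_k) :
  dotp (emb (n := k.+1) y) (emb (n := k.+1) y) = dotp y y.
Proof.
rewrite /dotp big_ord_recr/= emb_max mulr0 addr0.
by apply: eq_bigr => i _; rewrite emb_widen.
Qed.

Lemma embN {R : realType} {k} (y : 'rV[R]_k) :
  emb (n := k.+1) (- y) = - emb (n := k.+1) y.
Proof.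
by apply/rowP => i; rewrite !mxE; case: insub => [j|]; rewrite ?mxE ?oppr0.
Qed.

Lemma enorm_hh_emb {R : realType} {k} (nu : 'rV[R]_k.+1) (y : 'rV[R]_k) :
  enorm (hh nu (emb (n := k.+1) y)) = enorm y.
Proof. by rewrite /enorm dotp_hh dotp_emb. Qed.

Lemma enorm_elast {R : realType} {k} : enorm (elast R k.+1) = 1.
Proof.
rewrite /enorm /dotp (bigD1 ord_max)//= big1 ?addr0.
  by rewrite !mxE/= eqxx mulr1 sqrtr1.
move=> i im; rewrite !mxE/=; case: eqVneq => [ik|]; last by rewrite mulr0.
by case/eqP: im; exact: val_inj.
Qed.

(** * The mean over a disc *)

Section disc_mean.
Context {R : realType} {k : nat}.
Variables (eps : R) (nu : 'rV[R]_k.+1).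
Hypothesis eps_gt0 : 0 < eps.

Implicit Types g : 'rV[R]_k.+1 -> R.

(** The bound is asked on the disc only, since the linear forms and exponentials to be averaged are
    unbounded on the whole space. *)
Definition disc_regular g : Prop :=
  vborel g /\ exists C : R, forall h, enorm h < eps -> `|g h| <= C.

Let on_disc g (y : 'rV[R]_k) : R :=
  ((enorm y < eps)%R : bool)%:R * g (hh nu (emb (n := k.+1) y)).

Let favgE g :
  favg eps nu g = iint (on_disc g) / iint (on_disc (fun _ => 1)).
Proof.
rewrite /favg/=; congr (iint _ / iint _).
by apply/funext => y; rewrite /on_disc mulr1.
Qed.

Lemma iintable_on_disc g : disc_regular g -> iintable (on_disc g).
Proof.
move=> [bg [C gC]]; split.
  move=> d S _ q _ mq.
  rewrite [X in measurable_fun _ X](_ : _ = (fun s =>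
      if dotp (\row_i q i s) (\row_i q i s) < eps ^+ 2
      then g (hh nu (emb (n := k.+1) (\row_i q i s))) else 0)); last first.
    apply/funext => s; rewrite /on_disc enorm_lt//.
    by case: ifPn; rewrite ?mul1r ?mul0r.
  apply: measurable_fun_ifT => //.
    apply: measurable_fun_ltr => //.
    apply: (vborel_dotpp (n := k)) => i.
    under eq_fun do rewrite mxE.
    exact: mq.
  apply: (bg _ _ (fun s => hh nu (emb (n := k.+1) (\row_i q i s)))) => i.
  have me j : measurable_fun setT (fun s => emb (n := k.+1) (\row_i q i s) 0 j).
    under eq_fun do rewrite mxE.
    case: insub => [l|]; last exact: measurable_cst.
    under eq_fun do rewrite mxE.
    exact: mq.
  rewrite /hh /=; case: (elast R k.+1 - nu == 0) => //.
  have subE (z w : 'rV[R]_k.+1) c : (z - c *: w) 0 i = z 0 i - c * w 0 i.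
    by rewrite !mxE.
  rewrite (funext (fun s => subE _ _ _)).
  apply: measurable_funB => //; apply: measurable_funM => //.
  apply: measurable_funM => //; apply: measurable_funM => //.
  by apply: measurable_sum => j; exact: measurable_funM.
(* The absolute value provides a nonnegative bound off the disc, where the integrand vanishes. *)
exists `|C|, eps => _ y; split.
  rewrite /on_disc; case: (ltP (enorm y) eps) => ye.
    rewrite mul1r (le_trans (gC _ _))// ?ler_norm//.
    by rewrite enorm_hh_emb.
  by rewrite mul0r normr0.
move=> i yi; rewrite /on_disc ltNge.
suff -> : eps <= enorm y by rewrite mul0r.
rewrite leNgt enorm_lt// -leNgt.
apply: le_trans (dotp_ge_coord y i).
by rewrite -[leRHS]real_normK ?num_real// ler_pXn2r ?nnegrE ?ltW// (lt_trans eps_gt0).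
Qed.

(** The cube [[r / 2, r]^k] lies in the disc, because [k r^2 < (k + 1)^2 r^2 = eps^2], and it stays
    away from the origin, so that [|h|^2] is bounded below on it when [0 < k]. *)
Let r := eps / k.+1%:R.

Let r_gt0 : 0 < r. Proof. by rewrite divr_gt0. Qed.

Let enorm_box (y : 'rV[R]_k) :
  (forall i, r / 2 <= y 0 i <= r) -> enorm y < eps.
Proof.
move=> yr; rewrite enorm_lt//.
have : dotp y y <= \sum_(i < k) r ^+ 2.
  apply: ler_sum => i _; rewrite -expr2 ler_pXn2r ?nnegrE ?(ltW r_gt0)//.
    by have /andP[] := yr i.
  have /andP[+ _] := yr i; apply: le_trans; rewrite divr_ge0// ltW//.
move=> /le_lt_trans; apply; rewrite sumr_const card_ord -mulr_natl.
have er : eps = r * k.+1%:R by rewrite /r divfK.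
rewrite er (exprMn 2 r) mulrC ltr_pM2l ?exprn_gt0//.
by rewrite -natrX ltr_nat (@leq_trans (k.+1 ^ 1))// leq_pexp2l.
Qed.

Let iint_on_disc_gt0 g (c : R) : disc_regular g -> 0 < c ->
  (forall h, enorm h < eps -> 0 <= g h) ->
  (forall y : 'rV[R]_k, (forall i, r / 2 <= y 0 i <= r) ->
     c <= g (hh nu (emb (n := k.+1) y))) ->
  0 < iint (on_disc g).
Proof.
move=> dg c0 g0 gc.
have r2 : r / 2 < r by rewrite ltr_pdivrMr// mulr_natr mulr2n ltrDl.
have p0 : 0 < c * (r - r / 2) ^+ k by rewrite mulr_gt0// exprn_gt0// subr_gt0.
apply: (lt_le_trans p0); apply: iint_box_le => //.
- exact: iintable_on_disc.
- move=> y; rewrite /on_disc; case: (ltP (enorm y) eps) => ye.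
    by rewrite mul1r g0// enorm_hh_emb.
  by rewrite mul0r.
- exact: ltW.
- by move=> y yr; rewrite /on_disc enorm_box// mul1r gc.
Qed.

Lemma disc_regular_cst c : disc_regular (fun _ => c).
Proof. by split; [exact: vborel_cst|exists `|c|]. Qed.

Lemma disc_mass_gt0 : 0 < iint (on_disc (fun _ => 1)).
Proof. by apply: (@iint_on_disc_gt0 _ 1) => //; exact: disc_regular_cst. Qed.

Lemma favg_le g1 g2 : disc_regular g1 -> disc_regular g2 ->
  (forall h, enorm h < eps -> g1 h <= g2 h) -> favg eps nu g1 <= favg eps nu g2.
Proof.
move=> d1 d2 g12; rewrite !favgE ler_pM2r ?invr_gt0 ?disc_mass_gt0//.
apply: iint_le; try exact: iintable_on_disc.
move=> y; rewrite /on_disc; case: (ltP (enorm y) eps) => ye.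
  by rewrite !mul1r g12// enorm_hh_emb.
by rewrite !mul0r.
Qed.

Lemma eq_favg g1 g2 : (forall h, enorm h < eps -> g1 h = g2 h) ->
  favg eps nu g1 = favg eps nu g2.
Proof.
move=> g12; rewrite !favgE; congr (iint _ / _); apply/funext => y.
rewrite /on_disc; case: (ltP (enorm y) eps) => ye; last by rewrite !mul0r.
by rewrite g12// enorm_hh_emb.
Qed.

Lemma favgD g1 g2 : disc_regular g1 -> disc_regular g2 ->
  favg eps nu (fun h => g1 h + g2 h) = favg eps nu g1 + favg eps nu g2.
Proof.
move=> d1 d2; rewrite !favgE -mulrDl -iintD; try exact: iintable_on_disc.
by congr (iint _ / _); apply/funext => y; rewrite /on_disc mulrDr.
Qed.

Lemma favgZ c g : disc_regular g ->
  favg eps nu (fun h => c * g h) = c * favg eps nu g.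
Proof.
move=> dg; rewrite !favgE mulrA -iintZ; last exact: iintable_on_disc.
by congr (iint _ / _); apply/funext => y; rewrite /on_disc mulrCA.
Qed.

Lemma favg1 : favg eps nu (fun _ => 1) = 1.
Proof. by rewrite favgE divff// gt_eqF// disc_mass_gt0. Qed.

(** The disc is symmetric and [emb] and [hh nu] commute with negation, so the integral equals its
    own opposite. *)
Lemma favg_odd g : disc_regular g -> (forall h, g (- h) = - g h) ->
  favg eps nu g = 0.
Proof.
move=> dg gN; rewrite favgE.
suff : iint (on_disc g) = - iint (on_disc g).
  by move/eqP; rewrite -addr_eq0 -mulr2n mulrn_eq0 => /eqP ->; rewrite mul0r.
rewrite -[LHS]iintN; last exact: iintable_on_disc.
rewrite -mulN1r -iintZ; last exact: iintable_on_disc.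
congr iint; apply/funext => y; rewrite /on_disc embN hhN gN mulN1r mulrN.
by rewrite /enorm dotpNr dotpC dotpNr opprK.
Qed.

Lemma disc_regular_sqr : disc_regular (fun h => dotp h h).
Proof.
split; first exact: vborel_dotpp.
by exists (eps ^+ 2) => h he; rewrite ger0_norm ?dotp_ge0// ltW// -enorm_lt.
Qed.

(** Here the dimension enters: [0 < k] supplies a coordinate, which is at least [r / 2] on the
    cube. *)
Lemma favg_sqr_gt0 : (0 < k)%N -> 0 < favg eps nu (fun h => dotp h h).
Proof.
move=> k0; rewrite favgE divr_gt0 ?disc_mass_gt0//.
apply: (@iint_on_disc_gt0 _ ((r / 2) ^+ 2)).
- exact: disc_regular_sqr.
- by rewrite exprn_gt0// divr_gt0.
- by move=> h _; exact: dotp_ge0.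
- move=> y yr; rewrite dotp_hh dotp_emb.
  apply: le_trans (dotp_ge_coord y (Ordinal k0)).
  have /andP[yr1 _] := yr (Ordinal k0).
  have r20 : 0 <= r / 2 by rewrite divr_ge0// ltW.
  by rewrite ler_pXn2r// nnegrE// (le_trans r20).
Qed.

End disc_mean.

(** * The exponential barrier *)

(** As [hh] preserves the norm, the second moment is one constant for all directions; this makes the
    barrier uniform in [nu]. *)
Lemma favg_sqr_indep {R : realType} {k} (eps : R) (nu nu' : 'rV[R]_k.+1) :
  favg eps nu (fun h => dotp h h) = favg eps nu' (fun h => dotp h h).
Proof.
rewrite /favg; congr (iint _ / _).
by apply/funext => y; rewrite !dotp_hh.
Qed.

Lemma disc_regularD {R : realType} {k} (eps : R) (g1 g2 : 'rV[R]_k.+1 -> R) :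
  disc_regular eps g1 -> disc_regular eps g2 ->
  disc_regular eps (fun h => g1 h + g2 h).
Proof.
move=> [b1 [C1 g1C]] [b2 [C2 g2C]]; split; first exact: vborelD.
exists (C1 + C2) => h he; rewrite (le_trans (ler_normD _ _))// lerD//.
  exact: g1C.
exact: g2C.
Qed.

Lemma disc_regularZ {R : realType} {k} (eps c : R) (g : 'rV[R]_k.+1 -> R) :
  disc_regular eps g -> disc_regular eps (fun h => c * g h).
Proof.
move=> [b [C gC]]; split; first by apply: vborelM => //; exact: vborel_cst.
by exists (`|c| * C) => h he; rewrite normrM ler_wpM2l// gC.
Qed.

(** Nonnegativity of [|x + h|^2] and [|x - h|^2] bounds [2 |<x, h>|] by [|x|^2 + |h|^2]. *)
Lemma disc_regular_dotp {R : realType} {k} (eps : R) (x : 'rV[R]_k.+1) :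
  0 < eps -> disc_regular eps (dotp x).
Proof.
move=> e0; split; first exact: vborel_dotp.
exists (dotp x x + eps ^+ 2) => h; rewrite enorm_lt// => he.
have := dotp_ge0 (x + h); have := dotp_ge0 (x - h).
rewrite !dotp_sqrD !dotpNr (dotpC (- h)) dotpNr opprK => h1 h2.
have := dotp_ge0 x; have := dotp_ge0 h => x0 h0.
by rewrite ler_norml; apply/andP; split; lra.
Qed.

(** The factor [exp (lam |x|^2)] comes out; the rest is [exp s >= 1 + s] with
    [s = lam |h|^2 + 2 lam <x, h>], whose linear term is odd and averages to 0. *)
Lemma favg_expR_ge {R : realType} {k} (eps lam : R) (nu x : 'rV[R]_k.+1) :
  0 < eps -> 0 <= lam ->
  expR (lam * dotp x x) * (1 + lam * favg eps nu (fun h => dotp h h)) <=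
  favg eps nu (fun h => expR (lam * dotp (x + h) (x + h))).
Proof.
move=> e0 l0.
have rsq := disc_regular_sqr (k := k) e0.
have rx := disc_regular_dotp x e0.
have r1 : disc_regular eps (fun h => lam * dotp h h + 2 * lam * dotp x h).
  by apply: disc_regularD; exact: disc_regularZ.
have r2 : disc_regular eps (fun h => 1 + (lam * dotp h h + 2 * lam * dotp x h)).
  by apply: disc_regularD => //; exact: disc_regular_cst.
have -> : expR (lam * dotp x x) * (1 + lam * favg eps nu (fun h => dotp h h)) =
    favg eps nu (fun h => expR (lam * dotp x x) *
      (1 + (lam * dotp h h + 2 * lam * dotp x h))).
  rewrite favgZ// favgD//; last exact: disc_regular_cst.
  rewrite favg1// favgD//; try exact: disc_regularZ.
  rewrite !favgZ// (favg_odd _ e0 rx) ?mulr0 ?addr0//.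
  by move=> h; exact: dotpNr.
apply: (@favg_le _ _ _ nu e0); first exact: disc_regularZ.
- split.
    apply: vborel_expR; apply: vborelM; first exact: vborel_cst.
    exact: (vborel_shift x vborel_dotpp).
  exists (expR (lam * (2 * dotp x x + 2 * eps ^+ 2))) => h.
  rewrite enorm_lt// => he; rewrite ger0_norm ?expR_ge0// ler_expR ler_wpM2l//.
  by rewrite (le_trans (dotp_sqrD_le _ _))// lerD2l ler_pM2l// ltW.
- move=> h _; rewrite dotp_sqrD.
  have -> : lam * (dotp x x + 2 * dotp x h + dotp h h) =
    lam * dotp x x + (lam * dotp h h + 2 * lam * dotp x h) by ring.
  by rewrite expRD ler_pM2l ?expR_gt0// expR_ge1Dx.
Qed.

Lemma barrier_exists {R : realType} {k} (alpha beta eps M : R) :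
  (0 < k)%N -> 0 < alpha -> 0 < beta -> alpha + beta = 1 -> 0 < eps -> 0 <= M ->
  exists (v : 'rV[R]_k.+1 -> R) (kap V : R),
    [/\ 0 <= kap < 1, vborel v, forall x, v x <= V,
      forall x h, dotp x x <= M -> dotp h h <= eps ^+ 2 -> 1 <= v (x + h) &
      forall x nu, dotp x x <= M ->
        alpha * v (x + eps *: nu) + beta * favg eps nu (fun h => v (x + h))
        <= kap * v x].
Proof.
move=> k0 a0 b0 ab1 e0 M0.
pose c := favg eps (0 : 'rV[R]_k.+1) (fun h => dotp h h).
have c0 : 0 < c by exact: favg_sqr_gt0.
(* With this choice [beta * (1 + lam * c) = beta + 2]. *)
pose lam := 2 / (beta * c).
have l0 : 0 <= lam by rewrite divr_ge0// mulr_ge0// ltW.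
pose Psi (x : 'rV[R]_k.+1) := expR (lam * dotp x x).
(* An upper bound for [Psi] at all points within [eps] of some [x] with [|x|^2 <= M]. *)
pose K := expR (lam * (2 * M + 2 * eps ^+ 2)).
have K1 : 1 <= K.
  rewrite -expR0 ler_expR mulr_ge0// addr_ge0// mulr_ge0//; exact: sqr_ge0.
have Psi1 x : 1 <= Psi x by rewrite -expR0 ler_expR mulr_ge0// dotp_ge0.
have PsiK x h : dotp x x <= M -> dotp h h <= eps ^+ 2 -> Psi (x + h) <= K.
  move=> xM he; rewrite ler_expR ler_wpM2l// (le_trans (dotp_sqrD_le _ _))//.
  by rewrite lerD// ler_pM2l.
have bPsi : vborel Psi.
  by apply: vborel_expR; apply: vborelM; [exact: vborel_cst|exact: vborel_dotpp].
(* The barrier is at least [K >= 1] near the domain and at most [2 K] everywhere; hence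
   [v / (2 K) <= 1], and passing from [v] to [kap * v] costs at most 1. *)
exists (fun x => 2 * K + (-1) * Psi x), (1 - (2 * K)^-1), (2 * K); split.
- have K20 : 0 < 2 * K by rewrite mulr_gt0// (lt_le_trans _ K1).
  rewrite subr_ge0 invf_le1// gtrBl invr_gt0 K20 andbT.
  by rewrite (le_trans K1)// ler_peMl// ?ler1n// (le_trans _ K1).
- apply: vborelD; first exact: vborel_cst.
  by apply: vborelM => //; exact: vborel_cst.
- by move=> x; have := Psi1 x; lra.
- by move=> x h xM he; have := PsiK x h xM he; lra.
move=> x nu xM.
have rPsi : disc_regular eps (fun h => Psi (x + h)).
  split; first exact: vborel_shift.
  exists K => h; rewrite enorm_lt// => he.
  by rewrite ger0_norm ?expR_ge0// PsiK// ltW.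
rewrite favgD//; [|exact: disc_regular_cst|exact: disc_regularZ].
rewrite (favgZ nu e0 (-1) rPsi).
have -> : favg eps nu (fun=> 2 * K) = 2 * K.
  have := favgZ nu e0 (2 * K) (disc_regular_cst eps 1); by rewrite favg1// mulr1.
have := favg_expR_ge nu x e0 l0; rewrite -/(Psi x) (favg_sqr_indep _ nu 0) -/c.
move=> /(ler_wpM2l (ltW b0)).
rewrite [leLHS](_ : _ = Psi x * beta + 2 * Psi x); last first.
  by rewrite /lam; field; rewrite !gt_eqF.
set P := favg _ _ _ => hP.
have : 0 <= alpha * Psi (x + eps *: nu) by rewrite mulr_ge0// ?expR_ge0// ltW.
have : 0 <= Psi x * beta by rewrite mulr_ge0// ?expR_ge0// ltW.
have -> : (1 - (2 * K)^-1) * (2 * K + -1 * Psi x) =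
  2 * K - Psi x - 1 + Psi x / (2 * K) by field; rewrite gt_eqF// (lt_le_trans _ K1).
have : 0 <= Psi x / (2 * K).
  by rewrite divr_ge0// ?expR_ge0// mulr_ge0// (le_trans _ K1).
have -> : alpha * (2 * K + -1 * Psi (x + eps *: nu)) + beta * (2 * K + -1 * P) =
  (alpha + beta) * (2 * K) - alpha * Psi (x + eps *: nu) - beta * P by ring.
(* After dropping nonnegative terms the claim is [2 K - 2 Psi x <= 2 K - Psi x - 1], that is,
   [1 <= Psi x]. *)
by rewrite ab1; have := Psi1 x; lra.
Qed.

(** * Comparison of two functions through one averaging step *)

(** Supremum and infimum each move by at most [e]; the common bound [C] and a point of [P] ensure
    that they are not default values. *)
Lemma midrange_lip {R : realType} {T : Type} (P : set T) (F G : T -> R) (C e : R) :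
  P !=set0 -> (forall z, P z -> `|F z| <= C) -> (forall z, P z -> `|G z| <= C) ->
  (forall z, P z -> `|F z - G z| <= e) ->
  `|midrange (F @` P) - midrange (G @` P)| <= e.
Proof.
move=> [z0 Pz0].
wlog suff hle : F G / (forall z, P z -> `|F z| <= C) ->
    (forall z, P z -> `|G z| <= C) -> (forall z, P z -> `|F z - G z| <= e) ->
    midrange (F @` P) - midrange (G @` P) <= e.
  move=> FC GC FGe; rewrite ler_norml lerNl opprB; apply/andP; split; apply: hle => //.
  by move=> z Pz; rewrite distrC FGe.
move=> FC GC FGe.
have ub H : (forall z, P z -> `|H z| <= C) -> has_ubound (H @` P).
  by move=> HC; exists C => _ [z Pz <-]; rewrite (le_trans (ler_norm _))// HC.
have lb H : (forall z, P z -> `|H z| <= C) -> has_lbound (H @` P).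
  move=> HC; exists (- C) => _ [z Pz <-]; rewrite lerNl.
  by rewrite (le_trans _ (HC _ Pz))// -normrN ler_norm.
have s1 : sup (F @` P) <= sup (G @` P) + e.
  apply: ge_sup; first by exists (F z0), z0.
  move=> _ [z Pz <-]; have := FGe z Pz; rewrite ler_norml => /andP[_].
  have : G z <= sup (G @` P) by apply: (ub_le_sup (ub _ GC)); exists z.
  lra.
have s2 : inf (F @` P) - e <= inf (G @` P).
  apply: lb_le_inf; first by exists (G z0), z0.
  move=> _ [z Pz <-]; have := FGe z Pz; rewrite ler_norml => /andP[_].
  have : inf (F @` P) <= F z by apply: (ge_inf (lb _ FC)); exists z.
  lra.
rewrite /midrange; lra.
Qed.

(** The operator at a frozen time, shared by the parabolic equation (with [f] a time slice of [u])
    and the stationary one. *)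
Definition disc_step {R : realType} {n} (alpha beta eps : R) (x : 'rV[R]_n)
    (f : 'rV[R]_n -> R) (nu : 'rV[R]_n) : R :=
  alpha * f (x + eps *: nu) + beta * favg eps nu (fun h => f (x + h)).

Section one_step.
Context {R : realType} {k : nat}.
Variables (alpha beta eps : R) (D : set 'rV[R]_k.+1) (x : 'rV[R]_k.+1).
Hypotheses (alpha_gt0 : 0 < alpha) (beta_gt0 : 0 < beta).
Hypotheses (alphaDbeta : alpha + beta = 1) (eps_gt0 : 0 < eps).
(** The ball is closed because [eps *: nu] has norm exactly [eps]. *)
Hypothesis xD : forall h, enorm h <= eps -> D (x + h).

Implicit Types f g : 'rV[R]_k.+1 -> R.

Local Notation step := (disc_step alpha beta eps x).

(** Extension by zero gives a globally Borel function from one that is Borel on [D] only; the mean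
    does not see the change, as the disc around [x] lies in [D]. *)
Let cut f (y : 'rV[R]_k.+1) : R := if y \in D then f y else 0.

Let favg_cut f (nu : 'rV[R]_k.+1) :
  favg eps nu (fun h => f (x + h)) = favg eps nu (fun h => cut f (x + h)).
Proof. by apply: eq_favg => h /ltW he; rewrite /cut mem_set//; exact: xD. Qed.

Let cut_regular f (C : R) : borel_on D f -> (forall y, D y -> `|f y| <= C) ->
  disc_regular eps (fun h => cut f (x + h)).
Proof.
move=> bf fC; split; first exact/vborel_shift/borel_on_vborel.
by exists C => h /ltW he; rewrite /cut mem_set ?fC//; exact: xD.
Qed.

Let favg_cst c (nu : 'rV[R]_k.+1) : favg eps nu (fun=> c) = c.
Proof.
have -> : (fun _ : 'rV[R]_k.+1 => c) = (fun=> c * 1) by rewrite mulr1.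
by rewrite favgZ// ?favg1 ?mulr1//; exact: disc_regular_cst.
Qed.

Let sphere_step (nu : 'rV[R]_k.+1) : sphere nu -> enorm (eps *: nu) <= eps.
Proof. by move=> n1; rewrite enormZ n1 mulr1 gtr0_norm. Qed.

Lemma step_bounded f C nu : borel_on D f -> (forall y, D y -> `|f y| <= C) ->
  sphere nu -> `|step f nu| <= C.
Proof.
move=> bf fC /sphere_step n1; rewrite /disc_step favg_cut.
have rf := cut_regular bf fC.
have ub : favg eps nu (fun h => cut f (x + h)) <= C.
  rewrite -[leRHS](favg_cst C nu); apply: favg_le => //.
    exact: disc_regular_cst.
  move=> h /ltW he; rewrite /cut mem_set; last exact: xD.
  by rewrite (le_trans (ler_norm _))// fC//; exact: xD.
have lb : - C <= favg eps nu (fun h => cut f (x + h)).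
  rewrite -[leLHS](favg_cst (- C) nu); apply: favg_le => //.
    exact: disc_regular_cst.
  move=> h /ltW he; rewrite /cut mem_set; last exact: xD.
  by have := fC _ (xD he); rewrite ler_norml => /andP[].
have := fC _ (xD n1); rewrite !ler_norml => /andP[l1 u1].
have -> : C = alpha * C + beta * C by rewrite -mulrDl alphaDbeta mul1r.
rewrite opprD -!mulrN; apply/andP; split.
  by apply: lerD; rewrite ler_pM2l.
by apply: lerD; rewrite ler_pM2l.
Qed.

(** The [alpha]-part is pointwise; in the [beta]-part the mean is monotone and linear, applied to
    [f <= g + m * v]. *)
Lemma step_le f g (v : 'rV[R]_k.+1 -> R) C m nu :
  borel_on D f -> (forall y, D y -> `|f y| <= C) ->
  borel_on D g -> (forall y, D y -> `|g y| <= C) ->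
  disc_regular eps (fun h => v (x + h)) ->
  (forall h, enorm h <= eps -> f (x + h) - g (x + h) <= m * v (x + h)) ->
  sphere nu -> step f nu - step g nu <= m * step v nu.
Proof.
move=> bf fC bg gC rv fgv /sphere_step n1; rewrite /disc_step (favg_cut f) (favg_cut g).
have rf := cut_regular bf fC; have rg := cut_regular bg gC.
have : favg eps nu (fun h => cut f (x + h)) <=
    favg eps nu (fun h => cut g (x + h) + m * v (x + h)).
  apply: favg_le => //.
    by apply: disc_regularD => //; exact: disc_regularZ.
  move=> h /ltW he; rewrite /cut mem_set; last exact: xD.
  by rewrite -lerBlDl fgv.
rewrite favgD//; last exact: disc_regularZ.
rewrite favgZ// -lerBlDl => /(ler_wpM2l (ltW beta_gt0)).
have /(ler_wpM2l (ltW alpha_gt0)) := fgv _ n1.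
set F := favg _ _ _; set G := favg _ _ _; set V := favg _ _ _ => h1 h2.
have -> : m * (alpha * v (x + eps *: nu) + beta * V) =
  alpha * (m * v (x + eps *: nu)) + beta * (m * V) by ring.
by apply: le_trans (lerD h1 h2); rewrite !mulrBr; lra.
Qed.

Lemma midrange_step_le f g (v : 'rV[R]_k.+1 -> R) C m kap :
  borel_on D f -> (forall y, D y -> `|f y| <= C) ->
  borel_on D g -> (forall y, D y -> `|g y| <= C) ->
  disc_regular eps (fun h => v (x + h)) -> 0 <= m ->
  (forall h, enorm h <= eps -> `|f (x + h) - g (x + h)| <= m * v (x + h)) ->
  (forall nu, step v nu <= kap * v x) ->
  `|midrange [set step f nu | nu in @sphere R k.+1]
    - midrange [set step g nu | nu in @sphere R k.+1]| <= m * (kap * v x).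
Proof.
move=> bf fC bg gC rv m0 fgv vk.
apply: (@midrange_lip _ _ _ _ _ C).
- by exists (elast R k.+1); exact: enorm_elast.
- by move=> nu nu1; exact: step_bounded.
- by move=> nu nu1; exact: step_bounded.
move=> nu nu1.
apply: (@le_trans _ _ (m * step v nu)); last by rewrite ler_wpM2l.
rewrite ler_norml lerNl opprB; apply/andP; split.
  apply: (@step_le _ _ _ C) => // h he; apply: le_trans (fgv _ he).
  by rewrite distrC ler_norm.
apply: (@step_le _ _ _ C) => // h he; apply: le_trans (fgv _ he).
exact: ler_norm.
Qed.

End one_step.

(** * Segments leaving an open set *)

Lemma nbhs_line {R : realType} {n} (x h : 'rV[R]_n) (t : R) (O : set 'rV[R]_n) :
  nbhs (x + t *: h) O ->
  exists2 d : R, 0 < d & forall s, `|s - t| < d -> O (x + s *: h).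
Proof.
move=> /nbhs_ballP[e /= e0 eO].
(* Adding 1 keeps the divisor positive when [h = 0]. *)
have h0 : 0 < enorm h + 1 by rewrite ltr_wpDl// enorm_ge0.
exists (e / (enorm h + 1)); first by rewrite divr_gt0.
move=> s st; apply: eO; split => // i j; rewrite /ball/= !mxE !ord1.
rewrite (_ : _ - _ = (t - s) * h 0 j); last by ring.
rewrite normrM distrC; move: st; rewrite ltr_pdivlMr//.
apply: le_lt_trans; rewrite ler_wpM2l//.
apply: (@le_trans _ _ (enorm h)); last by rewrite lerDl.
rewrite /enorm -sqrtr_sqr ler_wsqrtr//; exact: dotp_ge_coord.
Qed.

(** The parameter is the supremum of those with [x + s *: h] in [Om]: by openness that point is
    outside [Om], yet it is a limit of points of [Om]. *)
Lemma segment_bdry {R : realType} {n} (Om : set 'rV[R]_n) (x h : 'rV[R]_n) :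
  open Om -> Om x -> ~ Om (x + h) ->
  exists2 t : R, 0 < t <= 1 & bdry Om (x + t *: h).
Proof.
move=> oOm Omx nOm.
pose S := [set s : R | 0 <= s <= 1 /\ Om (x + s *: h)].
have S0 : S 0 by split; rewrite ?lexx ?ler01// scale0r addr0.
have hS : has_sup S.
  by split; [exists 0|exists 1 => s [/andP[]]].
pose t := sup S.
have t0 : 0 <= t by apply: (ub_le_sup hS.2 S0).
have t1 : t <= 1 by apply: ge_sup; [exists 0|move=> s [/andP[]]].
have nOmt : ~ Om (x + t *: h).
  move=> Omt; have [d d0 dO] := nbhs_line (open_nbhs_nbhs (conj oOm Omt)).
  have {}t1 : t < 1.
    by rewrite lt_neqAle t1 andbT; apply/eqP => t1'; apply: nOm;
      rewrite -[h]scale1r -t1'.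
  (* A parameter beyond [t], still at most 1 and within [d] of [t], would belong to [S]. *)
  pose s := Num.min 1 (t + d / 2).
  have ts : t < s by rewrite lt_min t1 ltrDl divr_gt0.
  have : s <= t.
    apply: (ub_le_sup hS.2); split.
      by rewrite (le_trans t0 (ltW ts)) ge_min lexx.
    apply: dO; rewrite ger0_norm ?subr_ge0 1?ltW// ltrBlDl.
    rewrite gt_min; apply/orP; right.
    by rewrite ltrD2l ltr_pdivrMr// mulr_natr mulr2n ltrDl.
  by rewrite leNgt ts.
exists t.
  rewrite t1 andbT lt_neqAle t0 andbT; apply/eqP => t0'; apply: nOmt.
  by rewrite -t0' scale0r addr0.
split; last by move=> /interior_subset.
move=> B /nbhs_line[d d0 dB].
have [s Ss] := sup_adherent d0 hS; rewrite -/t => ts.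
have st : s <= t by exact: (ub_le_sup hS.2).
exists (x + s *: h); split; first by case: Ss.
by apply: dB; rewrite distrC ger0_norm ?subr_ge0// ltrBlDl -ltrBlDr.
Qed.

Lemma dist_ge0 {R : realType} {n} (x : 'rV[R]_n) (A : set 'rV[R]_n) :
  0 <= dist x A.
Proof.
rewrite /dist; have [->|/set0P A0] := eqVneq A set0.
  by rewrite image_set0 inf0.
apply: lb_le_inf; last by move=> _ [y _ <-]; exact: enorm_ge0.
by case: A0 => y Ay; exists (enorm (x - y)), y.
Qed.

(** If [x + h] is outside the closure, the segment meets the boundary at some [t > 0], so the
    distance is at most [(1 - t) * eps]; this is strictly below [eps] even when [|h| = eps]. *)
Lemma Omegaeps_step {R : realType} {n} (Om : set 'rV[R]_n) (eps : R)
    (x h : 'rV[R]_n) :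
  0 < eps -> open Om -> Om x -> enorm h <= eps -> Omegaeps Om eps (x + h).
Proof.
move=> e0 oOm Omx he; have [cl|ncl] := pselect (closure Om (x + h)); first by left.
right; split => //.
have nOm : ~ Om (x + h) by move=> /subset_closure.
have [t /andP[t0 t1] bt] := segment_bdry oOm Omx nOm.
apply: (@le_lt_trans _ _ (enorm (x + h - (x + t *: h)))).
  apply: ge_inf; last by exists (x + t *: h).
  by exists 0 => _ [y _ <-]; exact: enorm_ge0.
have -> : x + h - (x + t *: h) = (1 - t) *: h.
  by rewrite opprD addrACA subrr add0r scalerBl scale1r.
rewrite enormZ ger0_norm ?subr_ge0//.
apply: (@le_lt_trans _ _ ((1 - t) * eps)); first by rewrite ler_wpM2l// subr_ge0.
by rewrite gtr_pMl// gtrBl.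
Qed.

Lemma Omegaeps_out {R : realType} {n} (Om : set 'rV[R]_n) (eps : R)
    (x : 'rV[R]_n) :
  open Om -> Omegaeps Om eps x -> ~ Om x -> (Oeps Om eps `|` bdry Om) x.
Proof.
by move=> oOm [clx|Ox] nOm; [right; split => // /interior_subset|left].
Qed.

(** * The weights and the space-time domain at late times *)

Lemma deltabar_out {R : realType} {n} (Om : set 'rV[R]_n) (eps : R)
    (x : 'rV[R]_n) :
  open Om -> Omegaeps Om eps x -> ~ Om x -> deltabar Om eps x = 1.
Proof.
move=> oOm xO nOm; rewrite /deltabar memNset; last by case.
by rewrite mem_set//; exact: Omegaeps_out.
Qed.

Lemma deltabar_bounds {R : realType} {n} (Om : set 'rV[R]_n) (eps : R)
    (x : 'rV[R]_n) : 0 < eps -> 0 <= 1 - deltabar Om eps x <= 1.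
Proof.
move=> e0; rewrite /deltabar; case: ifPn; last first.
  by move=> _; case: ifPn => _; rewrite ?subrr ?subr0 ?lexx ?ler01.
rewrite inE => -[_ xe]; rewrite opprB addrCA subrr addr0.
by rewrite divr_ge0 ?dist_ge0 ?ler_pdivrMr ?mul1r ?ltW.
Qed.

(** The horizon is [t] itself. The initial layers of [IepsT] and [OepsT] are already past, and
    [eps <= sqrt (2 t)] makes the time factor equal to 1. *)
Lemma delta_deltabar {R : realType} {n} (Om : set 'rV[R]_n) (eps t : R)
    (x : 'rV[R]_n) : 0 < eps -> open Om -> Omegaeps Om eps x -> eps ^+ 2 < t ->
  delta Om eps t x t = deltabar Om eps x.
Proof.
move=> e0 oOm xO et.
have e20 : 0 < eps ^+ 2 by rewrite exprn_gt0.
have t0 : 0 < t by rewrite (lt_trans e20).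
have e2t : eps ^+ 2 / 2 < t by lra.
have IE : ((x, t) \in IepsT Om eps t) = (x \in Ieps Om eps).
  apply/idP/idP; rewrite !inE /IepsT/= => -[].
  - by case=> Omx [_ xe]; split.
  - by case=> _ /andP[_]; rewrite ltNge (ltW e2t).
  - by move=> Omx xe; left; rewrite (ltW e2t) lexx.
have OE : ((x, t) \in OepsT Om eps t `|` parbdry Om t) =
          (x \in Oeps Om eps `|` bdry Om).
  apply/idP/idP; rewrite !inE /OepsT /parbdry/=.
  - case=> [[[ncl [xe _]]|[_ /andP[_]]]|[[_ t0']|[bx _]]].
    + by left; split.
    + by rewrite ltNge (ltW t0).
    + by move: t0; rewrite t0' ltxx.
    + by right.
  - case=> [[ncl xe]|bx].
    + by left; left; rewrite t0 lexx.
    + by right; right; rewrite t0 lexx.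
rewrite /delta /deltabar IE OE; case: ifPn => //; rewrite inE => -[_ xe].
congr (1 - _).
rewrite (min_r (x := 1) (y := dist x _ / eps)); last first.
  by rewrite ler_pdivrMr// mul1r ltW.
rewrite min_l ?mulr1// ler_pdivlMr// mul1r.
rewrite -[leLHS]gtr0_norm// -sqrtr_sqr ler_wsqrtr//; lra.
Qed.

(** This allows the horizon [T = t] in the parabolic equation. A point of the closure is
    approximated within [Om] at the same time [t]. *)
Lemma OmegaepsT_time {R : realType} {n} (Om : set 'rV[R]_n) (eps t : R)
    (x : 'rV[R]_n) : 0 < t -> Omegaeps Om eps x -> OmegaepsT Om eps t (x, t).
Proof.
move=> t0 [clx|[ncl xe]]; last by right; left; rewrite /= t0 lexx.
left => B [[P Q] /= [xP tQ] PQB].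
have [y [Omy Py]] := clx _ xP.
exists (y, t); split; first by split; rewrite //= t0 lexx.
by apply: PQB; split => //=; exact: nbhs_singleton.
Qed.

(** * Geometric decay in time and the limit *)

Theorem theorem4p2 (R : realType) (n : nat) (alpha beta eps : R)
    (Om : set 'rV[R]_n) (psi : 'rV[R]_n -> R) (phi : 'rV[R]_n -> R -> R)
    (u : 'rV[R]_n -> R -> R) (U : 'rV[R]_n -> R) :
  (2 <= n)%N ->
  0 < alpha -> 0 < beta -> alpha + beta = 1 ->
  (* Om is a bounded domain *)
  open Om -> connected Om -> Om !=set0 ->
  (exists M : R, forall x, Om x -> enorm x <= M) ->
  0 < eps ->
  {within Gammaeps Om eps, continuous psi} ->
  {within Omegaeps Om eps `*` `[- (eps ^+ 2 / 2), eps ^+ 2 / 2],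
     continuous (fun p : 'rV[R]_n * R => phi p.1 p.2)} ->
  (* u = u_eps : the bounded (Borel) solution of the parabolic DPP on every Omega_{eps,T} *)
  (exists M : R, forall T x t, eps ^+ 2 < T -> OmegaepsT Om eps T (x, t) -> `|u x t| <= M) ->
  (forall t, - (eps ^+ 2 / 2) < t -> borel_on (Omegaeps Om eps) (fun x => u x t)) ->
  (forall T x t, eps ^+ 2 < T -> OmegaepsT Om eps T (x, t) ->
     u x t = (1 - delta Om eps T x t)
               * midrange [set Aeps alpha beta eps u x (t - eps ^+ 2 / 2) nu | nu in @sphere R n]
             + delta Om eps T x t * Fdat eps psi phi x t) ->
  (* U = U_eps : the bounded (Borel) solution of the stationary DPP on Omega_eps *)
  (exists M : R, forall x, Omegaeps Om eps x -> `|U x| <= M) ->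
  borel_on (Omegaeps Om eps) U ->
  (forall x, Omegaeps Om eps x ->
     U x = (1 - deltabar Om eps x)
             * midrange [set alpha * U (x + eps *: nu)
                             + beta * favg eps nu (fun h => U (x + h)) | nu in @sphere R n]
           + deltabar Om eps x * psi x) ->
  forall x, Om x -> u x T @[T --> +oo] --> U x.
Proof.
(* With [n = k.+1] the disc has dimension [n.-1 = k], and [2 <= n] becomes [0 < k]. *)
case: n Om psi phi u U => [//|k] Om psi phi u U.
move=> k1 a0 b0 ab1 oOm _ _ [M0 OmM0] e0 _ _ [Mu uM] ub ueq [MU UM] Ub Ueq.
have e20 : 0 < eps ^+ 2 by rewrite exprn_gt0.
have OmM x : Om x -> dotp x x <= M0 ^+ 2.
  move=> /OmM0 xM; rewrite -enormE2 ler_pXn2r// nnegrE ?enorm_ge0//.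
  exact: le_trans (enorm_ge0 x) xM.
have [v [kap [V [/andP[kap0 kap1] bv vV v1 vstep]]]] :=
  barrier_exists k1 a0 b0 ab1 e0 (sqr_ge0 M0).
have near_v x h : Om x -> enorm h <= eps -> 1 <= v (x + h).
  move=> Omx he; apply: v1; first exact: OmM.
  by rewrite -enormE2 ler_pXn2r// nnegrE ?enorm_ge0// ltW.
have Om_v x : Om x -> 1 <= v x.
  move=> Omx; rewrite -[x]addr0; apply: near_v => //.
  by rewrite -(scale0r (elast R k.+1)) enormZ normr0 mul0r ltW.
have rv x : Om x -> disc_regular eps (fun h => v (x + h)).
  move=> Omx; split; first exact: vborel_shift.
  exists V => h /ltW he; rewrite ger0_norm ?vV//.
  by rewrite (le_trans ler01)// near_v.
have D_step x h : Om x -> enorm h <= eps -> Omegaeps Om eps (x + h).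
  by move=> Omx; exact: Omegaeps_step.
have Om_D x : Om x -> Omegaeps Om eps x by move=> ?; left; exact: subset_closure.
pose C := Num.max Mu MU.
have uC t y : eps ^+ 2 < t -> Omegaeps Om eps y -> `|u y t| <= C.
  move=> et Dy; rewrite le_max (uM t)//.
  by apply: OmegaepsT_time => //; exact: lt_trans et.
have UC y : Omegaeps Om eps y -> `|U y| <= C by move=> Dy; rewrite le_max UM// orbT.
(* At horizon [t] the parabolic equation takes the stationary form, with the slice of [u] at time
   [t - eps^2 / 2] in place of [U] on the right. *)
have ueq' t x : eps ^+ 2 < t -> Omegaeps Om eps x ->
    u x t = (1 - deltabar Om eps x) *
      midrange [set disc_step alpha beta eps x (u^~ (t - eps ^+ 2 / 2)) nu
               | nu in @sphere R k.+1] + deltabar Om eps x * psi x.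
  move=> et Dx; rewrite (ueq t x t et); last first.
    by apply: OmegaepsT_time => //; exact: lt_trans et.
  by rewrite delta_deltabar// /Fdat et.
have out t x : eps ^+ 2 < t -> Omegaeps Om eps x -> ~ Om x -> u x t = U x.
  move=> et Dx nOm; rewrite (ueq' t)// Ueq// deltabar_out//.
  by rewrite subrr !mul0r.
pose m := C + C.
(* Each time lapse [eps^2 / 2] gains one factor [kap]; the threshold keeps all [j] backward steps
   after time [eps^2]. For [j = 0], [m] bounds the difference and [1 <= v x]. *)
have decay j t x : eps ^+ 2 + j%:R * (eps ^+ 2 / 2) < t -> Om x ->
    `|u x t - U x| <= m * kap ^+ j * v x.
  have m0 y : Om y -> 0 <= m.
    by move=> Omy; have := UC _ (Om_D _ Omy); have := normr_ge0 (U y); rewrite /m; lra.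
  elim: j t x => [|j IH] t x.
    rewrite mul0r addr0 expr0 mulr1 => et Omx.
    apply: (@le_trans _ _ m).
      by rewrite (le_trans (ler_normB _ _))// lerD ?UC ?uC//; exact: Om_D.
    by rewrite ler_peMr ?Om_v// (m0 x).
  move=> et Omx.
  have ets : eps ^+ 2 + j%:R * (eps ^+ 2 / 2) < t - eps ^+ 2 / 2.
    by move: et; rewrite -natr1; lra.
  have es : eps ^+ 2 < t - eps ^+ 2 / 2.
    apply: le_lt_trans ets; rewrite lerDl mulr_ge0//; lra.
  have et' : eps ^+ 2 < t by lra.
  have mk0 : 0 <= m * kap ^+ j by rewrite mulr_ge0 ?exprn_ge0// (m0 x).
  rewrite (ueq' t x) ?Ueq//; try exact: Om_D.
  (* The [psi] terms cancel, leaving [1 - deltabar], which lies in [[0, 1]], times a difference of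
     midranges. *)
  rewrite opprD addrACA subrr addr0 -mulrBr.
  have /andP[d0 d1] := deltabar_bounds Om x e0.
  rewrite normrM ger0_norm//.
  apply: le_trans (ler_piMl _ d1) _ => //.
  have -> : m * kap ^+ j.+1 * v x = m * kap ^+ j * (kap * v x).
    by rewrite exprSr; ring.
  apply: (@midrange_step_le _ _ alpha beta eps (Omegaeps Om eps) x a0 b0 ab1 e0
    (fun h => D_step x h Omx) (u^~ (t - eps ^+ 2 / 2)) U v C
    (m * kap ^+ j) kap).
  - by apply: ub; lra.
  - by move=> y Dy; exact: uC.
  - exact: Ub.
  - exact: UC.
  - exact: rv.
  - exact: mk0.
  (* The induction hypothesis covers only points of [Om]; at the others the difference is zero and
     [v] is positive. *)
  - move=> h he; have [Omh|nOmh] := pselect (Om (x + h)); first exact: IH.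
    rewrite out//; last exact: D_step.
    by rewrite subrr normr0 mulr_ge0// (le_trans ler01)// near_v.
  - by move=> nu; apply: vstep; exact: OmM.
move=> x Omx.
apply/cvgrPdist_lt => e ee0.
(* One [N] with [m * V * kap^N < e] suffices, since [decay] at [N] holds for every later time. *)
have : (fun j => m * V * kap ^+ j) @ \oo --> (0 : R).
  rewrite -[X in _ --> X](mulr0 (m * V)); apply: cvgMr.
  by apply: cvg_expr; rewrite ger0_norm.
move=> /cvgrPdist_lt/(_ e ee0)[N _ /(_ N (leqnn N))] /=.
rewrite sub0r normrN => he.
exists (eps ^+ 2 + N%:R * (eps ^+ 2 / 2)); split; first exact: num_real.
move=> t Nt; rewrite distrC; apply: le_lt_trans (decay N t x Nt Omx) _.
apply: le_lt_trans he; apply: le_trans (ler_norm _).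
rewrite mulrAC ler_wpM2r ?exprn_ge0// ler_wpM2l//.
by have := UC _ (Om_D _ Omx); have := normr_ge0 (U x); rewrite /m; lra.
Qed.
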